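(* Let $(f_t,g_t)$, $t=1,\dots,T$ ($T\ge 2$), be i.i.d. across $t$ from a joint distribution $\mathcal D$ supported on admissible pairs. Then $$\mathbb E\{|C_{\mathsf{OPT}}-\bar C_{\mathsf{OPT}}|\}=O(\sqrt{T\log T}).$$ More generally, for $K$ loss sequences, with tuples $(f_t^1,\dots,f_t^K)$ i.i.d. across $t$ and each $f_t^k$ admissible, the analogous bound $\mathbb E\{|C_{\mathsf{OPT}}-\bar C_{\mathsf{OPT}}|\}=O(\sqrt{T\log(TK)})$ holds. The implied constants do not depend on $T$, $K$ or $\mathcal D$ (they may depend on $\mathcal X$, its dimension $d$, $B$ and $G$).
   Context: $\mathcal X\subset\mathbb R^d$ is closed and convex with finite Euclidean diameter $D$. A loss function $f:\mathcal X\to\mathbb R$ is admissible if it is convex, bounded in absolute value by $B$ on $\mathcal X$, and $G$-Lipschitz on $\mathcal X$ (Euclidean norm); a pair or tuple is admissible if all its components are. For two sequences: $C_{\mathsf{OPT}}=\min_{x\in\mathcal X}\max\{\sum_{t=1}^T f_t(x),\sum_{t=1}^T g_t(x)\}$ (a random variable), $\mu(x)=\mathbb E\{(f_t(x),g_t(x))\}$, and $\bar C_{\mathsf{OPT}}=T\cdot\min_{x\in\mathcal X}\max_{\theta\in\Delta_2}\theta^\top\mu(x)$, where $\Delta_K$ is the probability simplex in $\mathbb R^K$. For $K$ sequences: $C_{\mathsf{OPT}}=\min_{x\in\mathcal X}\max_{1\le k\le K}\sum_{t=1}^T f_t^k(x)$, $\mu(x)=\mathbb E\{(f_t^1(x),\dots,f_t^K(x))\}$,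 and $\bar C_{\mathsf{OPT}}=T\cdot\min_{x\in\mathcal X}\max_{\theta\in\Delta_K}\theta^\top\mu(x)$. *)

(* Defs.v *)
From HB Require Import structures.
From mathcomp Require Import all_boot all_order all_algebra.
From mathcomp Require Import all_classical all_reals all_analysis.

Set Implicit Arguments.
Unset Strict Implicit.
Unset Printing Implicit Defensive.

Import Order.TTheory GRing.Theory Num.Theory.
Import numFieldNormedType.Exports.

Local Open Scope classical_set_scope.
Local Open Scope ring_scope.

(** The norm that MathComp-Analysis puts on ['rV[R]_d] is the sup norm, hence
    the explicit Euclidean norm here.  Both induce the same topology, so the
    library's [closed] is the right one. *)
Definition dotv (R : realType) (d : nat) (u v : 'rV[R]_d) : R :=
  \sum_(i < d) u ord0 i * v ord0 i.

Definition enorm (R : realType) (d : nat) (u : 'rV[R]_d) : R :=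
  Num.sqrt (dotv u u).

Definition finite_ediam (R : realType) (d : nat) (X : set 'rV[R]_d) : Prop :=
  has_ubound [set enorm (x - y) | x in X & y in X].

(** A loss is a function on [X]; it is represented by a total function whose
    values outside [X] never matter. *)
Definition admissible (R : realType) (d : nat) (X : set 'rV[R]_d)
    (B G : {nonneg R}) (f : 'rV[R]_d -> R) : Prop :=
  [/\ convex_function X f,
      (forall x, X x -> `|f x| <= B%:num) &
      (forall x y, X x -> X y -> `|f x - f y| <= G%:num * enorm (x - y))].

Record loss (R : realType) (d : nat) (X : set 'rV[R]_d) (B G : {nonneg R}) :=
  Loss { loss_fun :> 'rV[R]_d -> R ;
         lossP : admissible X B G loss_fun }.

Section LossMeasurable.
Context (R : realType) (d : nat) (X : set 'rV[R]_d) (B G : {nonneg R}).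

Lemma admissible0 : admissible X B G (fun=> 0).
Proof.
split.
- by move=> t x y _ _; rewrite convmm.
- by move=> x _; rewrite normr0.
- by move=> x y _ _; rewrite subrr normr0 mulr_ge0// /enorm sqrtr_ge0.
Qed.

HB.instance Definition _ := gen_eqMixin (loss X B G).
HB.instance Definition _ := gen_choiceMixin (loss X B G).
HB.instance Definition _ := isPointed.Build (loss X B G) (Loss admissible0).

(** The sigma-algebra on admissible losses generated by the evaluations at
    the points of [X]; for Lipschitz losses it is also the Borel
    sigma-algebra of uniform convergence on a compact [X]. *)
Definition loss_measurable : set (set (loss X B G)) :=
  <<s \bigcup_(x in X)
        preimage_set_system setT (fun f : loss X B G => f x) measurable >>.

Let loss_measurable0 : loss_measurable set0.
Proof. exact: sigma_algebra0. Qed.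

Let loss_measurableC A : loss_measurable A -> loss_measurable (~` A).
Proof. exact: sigma_algebraC. Qed.

Let loss_measurableU (F : (set (loss X B G))^nat) :
  (forall i, loss_measurable (F i)) -> loss_measurable (\bigcup_i F i).
Proof. exact: sigma_algebra_bigcup. Qed.

Definition loss_display : measure_display.
Proof. by constructor. Qed.

HB.instance Definition _ := @isMeasurable.Build loss_display (loss X B G)
  loss_measurable loss_measurable0 loss_measurableC loss_measurableU.

End LossMeasurable.

(** In the product rule some [A t] may be [setT], so it covers all
    subfamilies. *)
Definition iid (dO dS : measure_display) (Omega : measurableType dO)
    (S : measurableType dS) (R : realType) (P : probability Omega R)
    (D : probability S R) (T : nat) (Z : 'I_T -> {mfun Omega >-> S}) : Prop :=
  (forall (t : 'I_T) (A : set S), measurable A -> distribution P (Z t) A = D A)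
  /\
  (forall A : 'I_T -> set S, (forall t, measurable (A t)) ->
    P (\bigcap_(t in [set: 'I_T]) (Z t @^-1` A t)) =
    (\prod_(t < T) P (Z t @^-1` A t))%E).

Definition simplex (R : realType) (K : nat) : set 'rV[R]_K :=
  [set theta | (forall k, 0 <= theta ord0 k) /\
               \sum_(k < K) theta ord0 k = 1].
Arguments simplex : clear implicits.

(** Below, [inf] over [X] and [sup] over the simplex or over ['I_K] ([0 < K])
    are attained: [X] is compact and nonempty and the functions involved are
    continuous on it. *)

(** [T * min_(x in X) max_(theta in simplex) theta^T mu(x)] *)
Definition minmax_mean (R : realType) (d K : nat) (X : set 'rV[R]_d) (T : nat)
    (mu : 'rV[R]_d -> 'rV[R]_K) : R :=
  T%:R * inf [set sup [set dotv theta (mu x) | theta in simplex R K] | x in X].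

Section TwoSequences.
Context (R : realType) (d : nat) (X : set 'rV[R]_d) (B G : {nonneg R}).
Local Notation lossXBG := (loss X B G).

Definition C_OPT2 (T : nat) (F : 'I_T -> lossXBG * lossXBG) : R :=
  inf [set Num.max (\sum_(t < T) (F t).1 x) (\sum_(t < T) (F t).2 x) | x in X].

Definition mean2 (D : probability (lossXBG * lossXBG)%type R)
    (x : 'rV[R]_d) : 'rV[R]_2 :=
  \row_(k < 2) (if k == ord0 then fine 'E_D[fun F => F.1 x]
                else fine 'E_D[fun F => F.2 x]).

Definition Cbar_OPT2 (T : nat) (D : probability (lossXBG * lossXBG)%type R)
    : R := minmax_mean X T (mean2 D).

End TwoSequences.

Section KSequences.
Context (R : realType) (d : nat) (X : set 'rV[R]_d) (B G : {nonneg R}).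
Context (K : nat).
Local Notation lossXBG := (loss X B G).

Definition C_OPT (T : nat) (F : 'I_T -> K.-tuple lossXBG) : R :=
  inf [set sup [set \sum_(t < T) tnth (F t) k x | k in [set: 'I_K]] | x in X].

Definition meanK (D : probability (K.-tuple lossXBG) R)
    (x : 'rV[R]_d) : 'rV[R]_K :=
  \row_(k < K) fine 'E_D[fun F => tnth F k x].

Definition Cbar_OPT (T : nat) (D : probability (K.-tuple lossXBG) R) : R :=
  minmax_mean X T (meanK D).

End KSequences.

(* Main.v *)
Require Import Defs.
From HB Require Import structures.
From mathcomp Require Import all_boot all_order all_algebra.
From mathcomp Require Import all_classical all_reals all_analysis.
From mathcomp Require Import measurable_realfun ring lra.

Set Implicit Arguments.
Unset Strict Implicit.
Unset Printing Implicit Defensive.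

Import Order.TTheory GRing.Theory Num.Theory.
Import numFieldNormedType.Exports.

Local Open Scope classical_set_scope.
Local Open Scope ring_scope.

(** Pathwise, [`|C_OPT - Cbar_OPT|] is at most the largest deviation of
    [\sum_t f_t^k x] from [T * mu_k x] over [x] in [X] and [k < K].  As all
    these functions are Lipschitz, [x] may be restricted to a grid net of mesh
    [1 / T], which has [O(T ^ d)] points, at the cost of an additive constant.
    The expected maximum of these [O(T ^ d * K)] centered sums of bounded i.i.d.
    variables is of order [sqrt (T * ln (T * K))] by a Hoeffding-type bound on
    exponential moments and a union bound. *)

Section Concentration.
Context {R : realType}.

(** * Maximal inequality over a finite probability space *)

(** For [y >= 1/2] one has [y <= 2 * y ^+ 2]. Otherwise [1 - y <= expR (- y)] gives [expR y <= (1 -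
    y)^-1 <= 1 + y + 2 * y ^+ 2]. The linear term is kept apart because it vanishes on averaging a
    centered variable. *)
Lemma expR_le_addr_expR_sqr (y : R) : expR y <= y + expR (2 * y ^+ 2).
Proof.
have [y_big|y_small] := leP (2^-1) y.
  have : expR y <= expR (2 * y ^+ 2) by rewrite ler_expR; nra.
  lra.
have h1 : (1 - y) * expR y <= 1.
  have := expR_ge1Dx (- y); rewrite expRN => h.
  have e0 := expR_gt0 y.
  by rewrite -ler_pdivlMr// mul1r.
have h2 : 1 <= (1 - y) * (1 + y + 2 * y ^+ 2) by nra.
have h3 : expR y <= 1 + y + 2 * y ^+ 2.
  have y1 : 0 < 1 - y by lra.
  by rewrite -(ler_pM2l y1) (le_trans h1).
have := expR_ge1Dx (2 * y ^+ 2); lra.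
Qed.

(** Hoeffding's lemma with the cruder constant 2 in place of 1/2. The sign of [lam] is free, so both
    tails are covered. *)
Lemma mgf_centered_le (Q : finType) (p v : Q -> R) (lam c : R) :
  (forall q, 0 <= p q) -> \sum_q p q = 1 -> (forall q, `|v q| <= c) ->
  \sum_q p q * v q = 0 ->
  \sum_q p q * expR (lam * v q) <= expR (2 * (lam * c) ^+ 2).
Proof.
move=> p0 p1 vc pv0.
pose E := expR (2 * (lam * c) ^+ 2).
have le_q q : p q * expR (lam * v q) <= lam * (p q * v q) + p q * E.
  rewrite mulrCA -mulrDr ler_wpM2l//.
  rewrite (le_trans (expR_le_addr_expR_sqr _))// lerD2l ler_expR ler_pM2l//.
  rewrite !exprMn ler_wpM2l ?sqr_ge0// -[X in X <= _]real_normK ?num_real//.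
  by rewrite lerXn2r ?nnegrE// (le_trans _ (vc q)).
rewrite (le_trans (ler_sum _ (fun q _ => le_q q)))//.
by rewrite big_split/= -mulr_sumr pv0 mulr0 add0r -mulr_suml p1 mul1r.
Qed.

(** Independence in finite form: under a product weight, the mean of a product over the samples
    factors. *)
Lemma sum_prod_ffun (Q : finType) (T : nat) (h : Q -> R) :
  \sum_(s : {ffun 'I_T -> Q}) \prod_t h (s t) = (\sum_q h q) ^+ T.
Proof.
by rewrite -(bigA_distr_bigA (fun=> h)) prodr_const card_ord.
Qed.

Lemma mgf_iid_sum_le (Q : finType) (T : nat) (p v : Q -> R) (lam c : R) :
  (forall q, 0 <= p q) -> \sum_q p q = 1 -> (forall q, `|v q| <= c) ->
  \sum_q p q * v q = 0 ->
  \sum_(s : {ffun 'I_T -> Q})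
    (\prod_t p (s t)) * expR (lam * \sum_t v (s t))
  <= expR (2 * (lam * c) ^+ 2 * T%:R).
Proof.
move=> p0 p1 vc pv0.
under eq_bigr do rewrite mulr_sumr expR_sum -big_split/=.
rewrite (sum_prod_ffun T (fun q => p q * expR (lam * v q))) expRM_natr.
rewrite lerXn2r ?nnegrE ?expR_ge0//; last exact: mgf_centered_le.
by apply: sumr_ge0 => q _; rewrite mulr_ge0 ?expR_ge0.
Qed.

(* [U] is the maximum.  From [1 + y <= expR y],
   [lam * U <= L - 1 + expR (- L) * expR (lam * U)]; the union bound over [J]
   and both signs controls the mean of [expR (lam * U)], and [L] is the log of
   that bound.  The choice of [lam] balances the two terms of [L / lam]. *)
Lemma mean_bigmax_le (Q J : finType) (T : nat) (p : Q -> R) (v : J -> Q -> R)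
    (c : R) :
  (0 < T)%N -> (0 < #|J|)%N ->
  (forall q, 0 <= p q) -> \sum_q p q = 1 -> (forall j q, `|v j q| <= c) ->
  (forall j, \sum_q p q * v j q = 0) ->
  \sum_(s : {ffun 'I_T -> Q})
    (\prod_t p (s t)) * \big[Num.max/0]_j `|\sum_t v j (s t)|
  <= (1 + 2 * c ^+ 2) * Num.sqrt (T%:R * ln (2 * #|J|)%:R).
Proof.
move=> T0 J0 p0 p1 vc pv0.
set U := fun s : {ffun 'I_T -> Q} => \big[Num.max/0]_j `|\sum_t v j (s t)|.
pose w (s : {ffun 'I_T -> Q}) := \prod_t p (s t).
have w0 s : 0 <= w s by apply: prodr_ge0.
have w1 : \sum_s w s = 1 by rewrite sum_prod_ffun p1 expr1n.
set m := (2 * #|J|)%:R : R.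
have m1 : 1 < m by rewrite ltr1n mul2n -addnn (leq_add J0 J0).
have lnm0 : 0 < ln m by rewrite ln_gt0.
have T0' : 0 < T%:R :> R by rewrite ltr0n.
pose lam : R := Num.sqrt (ln m / T%:R).
have lam0 : 0 < lam by rewrite sqrtr_gt0 divr_gt0.
pose L := ln m + 2 * (lam * c) ^+ 2 * T%:R.
(* Some [j] attains the maximum; depending on the sign of its sum, one of its two exponentials
   equals the left-hand side, and all other terms are nonnegative. *)
have U_exp s : expR (lam * U s) <=
    \sum_j (expR (lam * \sum_t v j (s t)) + expR (- lam * \sum_t v j (s t))).
  have [j0 _] : {j : J | j \in J}.
    by apply/sigW; move/card_gt0P: J0 => [j]; exists j.
  have [//|j _ Uj] := @eq_bigmax _ _ J 0 j0 predT
    (fun j => `|\sum_t v j (s t)|) isT.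
  rewrite /U Uj.
  rewrite (bigD1 j)//= -[leLHS]addr0 lerD//; last first.
    by apply: sumr_ge0 => i _; rewrite addr_ge0 ?expR_ge0.
  case: (ger0P (\sum_t v j (s t))) => _.
    by rewrite lerDl expR_ge0.
  by rewrite mulrN mulNr lerDr expR_ge0.
have U_lin s : lam * U s <= L - 1 + expR (- L) * expR (lam * U s).
  rewrite -expRD; have := expR_ge1Dx (- L + lam * U s); lra.
have meanU : lam * \sum_s w s * U s <= L.
  have le_s s : lam * (w s * U s) <= w s * (L - 1) + expR (- L) *
      \sum_j (w s * expR (lam * \sum_t v j (s t))
            + w s * expR (- lam * \sum_t v j (s t))).
    under eq_bigr do rewrite -mulrDr.
    rewrite -mulr_sumr mulrCA [expR _ * _]mulrCA -mulrDr ler_wpM2l//.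
    by rewrite (le_trans (U_lin s))// lerD2l ler_wpM2l ?expR_ge0.
  rewrite mulr_sumr (le_trans (ler_sum _ (fun s _ => le_s s)))//.
  rewrite big_split/= -mulr_suml w1 mul1r -mulr_sumr exchange_big/=.
  under eq_bigr do rewrite big_split/=.
  have le_j (j : J) :
      \sum_s w s * expR (lam * \sum_t v j (s t))
    + \sum_s w s * expR (- lam * \sum_t v j (s t))
    <= 2 * expR (2 * (lam * c) ^+ 2 * T%:R).
    rewrite mulr_natl mulr2n lerD//; first exact: mgf_iid_sum_le.
    have -> : (lam * c) ^+ 2 = (- lam * c) ^+ 2 by rewrite mulNr sqrrN.
    exact: mgf_iid_sum_le.
  rewrite -[leRHS](subrK 1) lerD2l.
  rewrite (le_trans (ler_wpM2l (expR_ge0 _) (ler_sum _ (fun j _ => le_j j))))//.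
  rewrite sumr_const -mulrnAl -mulrnA -/m.
  rewrite -[X in _ * (X * _)]lnK ?posrE ?(lt_trans ltr01)//.
  by rewrite -!expRD /L addNr expR0.
(* Since [lam ^+ 2 * T = ln m], both terms of [L] are multiples of [lam * (lam * T)], and [lam * T]
   is the square root in the goal. *)
have sqE : Num.sqrt (T%:R * ln m) = lam * T%:R.
  have TE : T%:R = Num.sqrt (T%:R ^+ 2) :> R by rewrite sqrtr_sqr ger0_norm.
  rewrite [RHS](_ : _ = lam * Num.sqrt (T%:R ^+ 2)); last by rewrite -TE.
  rewrite -sqrtrM; last by rewrite ltW// divr_gt0.
  by congr Num.sqrt; field; rewrite gt_eqF.
have lnmE : ln m = lam * (lam * T%:R).
  rewrite mulrA -expr2 sqr_sqrtr ?divfK ?gt_eqF//.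
  by rewrite ltW// divr_gt0.
rewrite -(ler_pM2l lam0) (le_trans meanU)// sqE /L {1}lnmE.
by rewrite le_eqVlt; apply/orP; left; apply/eqP; ring.
Qed.

(** * Deterministic comparison *)

Lemma delta_mx_simplex (K : nat) (k : 'I_K) :
  simplex R K (delta_mx ord0 k).
Proof.
split => [i|]; first by rewrite mxE eqxx ler0n.
rewrite (bigD1 k)//= mxE !eqxx big1 ?addr0// => i ik.
by rewrite mxE (negbTE ik) andbF.
Qed.

(** The value at a vertex of the simplex. With the converse bound for convex combinations below, the
    supremum over the simplex is the largest coordinate. *)
Lemma coef_le_sup_simplex (K : nat) (m : 'rV[R]_K) (k : 'I_K) :
  m ord0 k <= sup [set dotv theta m | theta in simplex R K].
Proof.
apply: ub_le_sup.
  exists (\sum_(i < K) `|m ord0 i|) => _ [theta [th0 th1] <-].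
  apply: ler_sum => i _; rewrite (le_trans (ler_norm _))// normrM ger0_norm//.
  rewrite ler_piMl// -th1 (bigD1 i)//= lerDl.
  by apply: sumr_ge0.
exists (delta_mx ord0 k); first exact: delta_mx_simplex.
rewrite /dotv (bigD1 k)//= mxE !eqxx mul1r big1 ?addr0// => i ik.
by rewrite mxE (negbTE ik) andbF mul0r.
Qed.

Lemma sup_simplex_le (K : nat) (m : 'rV[R]_K) (M : R) : (0 < K)%N ->
  (forall k, m ord0 k <= M) ->
  sup [set dotv theta m | theta in simplex R K] <= M.
Proof.
move=> K0 mM; apply: ge_sup.
  pose k0 := Ordinal K0.
  by exists (dotv (delta_mx ord0 k0) m), (delta_mx ord0 k0) => //;
    exact: delta_mx_simplex.
move=> _ [theta [th0 th1] <-].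
rewrite -[M]mul1r -th1 mulr_suml; apply: ler_sum => i _.
exact: ler_wpM2l.
Qed.

(** Maxima and infima are 1-Lipschitz for the uniform distance. The function [a] is described only
    as the least upper bound of the [S x k], so that it can be a binary maximum as well as a
    supremum over ['I_K]. *)
Lemma inf_minmax_close (d K T : nat) (X : set 'rV[R]_d) (a : 'rV[R]_d -> R)
    (S : 'rV[R]_d -> 'I_K -> R) (mu : 'rV[R]_d -> 'rV[R]_K) (M delta : R) :
  X !=set0 -> (0 < K)%N -> (0 < T)%N ->
  (forall x k, X x -> S x k <= a x) ->
  (forall x y, X x -> (forall k, S x k <= y) -> a x <= y) ->
  (forall x k, X x -> `|mu x ord0 k| <= M) ->
  (forall x k, X x -> `|S x k - T%:R * mu x ord0 k| <= delta) ->
  `|inf [set a x | x in X] - minmax_mean X T mu| <= delta.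
Proof.
move=> [x0 Xx0] K0 T0 a_ub a_lub mu_bd S_mu.
pose k0 := Ordinal K0.
have T0' : 0 < T%:R :> R by rewrite ltr0n.
set b := fun x => sup [set dotv theta (mu x) | theta in simplex R K].
have a_le x : X x -> a x <= T%:R * b x + delta.
  move=> Xx; apply: a_lub => // k.
  have h2 : S x k <= T%:R * mu x ord0 k + delta.
    by have := S_mu x k Xx; rewrite ler_distl => /andP[_].
  by rewrite (le_trans h2)// lerD2r ler_pM2l// coef_le_sup_simplex.
have b_le x : X x -> b x <= (a x + delta) / T%:R.
  move=> Xx; apply: sup_simplex_le => // k.
  rewrite ler_pdivlMr// mulrC.
  have := S_mu x k Xx; rewrite ler_distl => /andP[+ _].
  by rewrite lerBlDr => /le_trans; apply; rewrite lerD2r a_ub.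
(* [inf] is a genuine lower bound only for sets bounded below; the bound [M] on [mu] provides this
   for [b], then for [a]. *)
have b_lb : has_lbound [set b x | x in X].
  exists (- M) => _ [x Xx <-].
  rewrite (le_trans _ (coef_le_sup_simplex _ k0))//.
  by have := mu_bd x k0 Xx; rewrite ler_norml => /andP[].
have a_lb : has_lbound [set a x | x in X].
  exists (T%:R * - M - delta) => _ [x Xx <-].
  have bM : - M <= b x.
    rewrite (le_trans _ (coef_le_sup_simplex _ k0))//.
    by have := mu_bd x k0 Xx; rewrite ler_norml => /andP[].
  have := b_le x Xx; rewrite ler_pdivlMr// => h.
  by rewrite lerBlDr (le_trans _ h)// mulrC ler_pM2r.
rewrite /minmax_mean -/b ler_distl; apply/andP; split.
  rewrite lerBlDr -ler_pdivlMl// mulrC.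
  have : lbound [set (a x + delta) / T%:R | x in X] (inf [set b x | x in X]).
    move=> _ [x Xx <-]; rewrite (le_trans _ (b_le x Xx))//.
    by apply: ge_inf => //; exists x.
  move=> lb; rewrite ler_pdivlMr// mulrC -lerBlDr.
  apply: lb_le_inf; first by exists (a x0), x0.
  move=> _ [x Xx <-]; rewrite lerBlDr mulrC -ler_pdivlMr//.
  by apply: lb; exists x.
rewrite -lerBlDr mulrC -ler_pdivrMr//.
apply: lb_le_inf; first by exists (b x0), x0.
move=> _ [x Xx <-]; rewrite ler_pdivrMr// mulrC lerBlDr.
rewrite (le_trans _ (a_le x Xx))//.
by apply: ge_inf => //; exists x.
Qed.

(** * Finite nets of a set of finite diameter *)

Lemma coef_le_enorm (d : nat) (u : 'rV[R]_d) (i : 'I_d) :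
  `|u ord0 i| <= enorm u.
Proof.
rewrite -sqrtr_sqr ler_wsqrtr// /dotv (bigD1 i)//= -expr2 lerDl.
by apply: sumr_ge0 => j _; rewrite -expr2 sqr_ge0.
Qed.

Lemma enorm_le_coef (d : nat) (u : 'rV[R]_d) (e : R) : 0 <= e ->
  (forall i, `|u ord0 i| <= e) -> enorm u <= d%:R * e.
Proof.
move=> e0 ue.
rewrite -[leRHS]ger0_norm ?mulr_ge0// -sqrtr_sqr ler_wsqrtr//.
apply: (@le_trans _ _ (\sum_(i < d) e ^+ 2)).
  apply: ler_sum => i _; rewrite -expr2 -[leLHS]real_normK ?num_real//.
  by rewrite lerXn2r ?nnegrE.
rewrite sumr_const card_ord -[e ^+ 2 *+ d]mulr_natl exprMn ler_wpM2r ?sqr_ge0//.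
rewrite -natrX ler_nat expnS expn1.
by case: d {u ue} => // d; rewrite leq_pmulr.
Qed.

(** A box around [x0] is cut into cells of side [1 / n], and one point of [X] is chosen in each cell
    that meets [X]. The net must lie inside [X], as losses are controlled only there. The factor [m]
    does not depend on [n], so the net grows polynomially in [n]. *)
Lemma grid_net (d : nat) (X : set 'rV[R]_d) : X !=set0 -> finite_ediam X ->
  exists m : nat, forall n : nat, (0 < n)%N ->
  exists r : {ffun 'I_d -> 'I_(m * n).+1} -> 'rV[R]_d,
    (forall i, X (r i)) /\
    (forall x, X x -> exists i, enorm (x - r i) <= d%:R / n%:R).
Proof.
move=> [x0 Xx0] [D0 D0ub].
pose D := Num.max 0 D0.
have D_ge0 : 0 <= D by rewrite le_max lexx.
have XD x : X x -> enorm (x - x0) <= D.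
  by move=> Xx; rewrite le_max D0ub ?orbT//; exists x => //; exists x0.
exists (Num.truncn (2 * D)).+1 => n n0.
set m := (Num.truncn (2 * D)).+1.
have n0' : 0 < n%:R :> R by rewrite ltr0n.
(* Shifting by [D] makes coordinates nonnegative and scaling by [n] gives cells of side 1, so
   truncation reads off the cell. The values are at most [2 * D * n], hence below [m * n + 1]. *)
pose y (x : 'rV[R]_d) i : R := n%:R * ((x - x0) ord0 i + D).
pose cell (x : 'rV[R]_d) :=
  [ffun i => inord (Num.truncn (y x i)) : 'I_(m * n).+1].
have y_ge0 x i : X x -> 0 <= y x i.
  move=> Xx; rewrite mulr_ge0//.
  have := le_trans (coef_le_enorm (x - x0) i) (XD x Xx).
  by rewrite ler_norml -subr_ge0 opprK => /andP[].
have y_lt x i : X x -> (Num.truncn (y x i) < (m * n).+1)%N.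
  move=> Xx; rewrite truncn_lt_nat ?y_ge0//.
  have h := le_trans (coef_le_enorm (x - x0) i) (XD x Xx).
  have h1 := le_trans (ler_norm _) h.
  apply: (@le_lt_trans _ _ (n%:R * (2 * D))).
    by rewrite ler_pM2l// mulr_natl mulr2n lerD2r.
  apply: (@le_lt_trans _ _ ((m * n)%:R)); last by rewrite ltr_nat.
  by rewrite natrM mulrC ler_pM2r// ltW// truncnS_gt.
have cell_close x x' : X x -> X x' -> cell x = cell x' ->
    enorm (x - x') <= d%:R / n%:R.
  move=> Xx Xx' /ffunP cxx'.
  apply: enorm_le_coef; first by rewrite invr_ge0 ltW.
  move=> i; have := cxx' i; rewrite !ffunE => /(congr1 val)/=.
  rewrite !inordK ?y_lt// => yy.
  have /andP[l1 u1] := truncn_itv (y_ge0 x i Xx).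
  have /andP[l2 u2] := truncn_itv (y_ge0 x' i Xx').
  rewrite yy in l1 u1.
  rewrite -(ler_pM2l n0') divff ?gt_eqF//.
  rewrite -[X in X * `|_|]gtr0_norm// -normrM.
  have -> : n%:R * (x - x') ord0 i = y x i - y x' i.
    by rewrite /y !mxE; ring.
  rewrite -natr1 in u1 u2; rewrite ler_norml; lra.
(* Cells that miss [X] get the default point [x0]. *)
pose r c := if pselect (exists2 x, X x & cell x = c) is left h
            then sval (cid2 h) else x0.
exists r; split => [c|x Xx].
  by rewrite /r; case: pselect => // h; case: cid2.
exists (cell x); rewrite /r; case: pselect => [h|[]]; last by exists x.
by case: cid2 => x' Xx' /= cc; apply: cell_close.
Qed.

(** * Deviations of i.i.d. bounded functions *)

(* Unlike in [ge0_le_integral], [f] need not be measurable: the integral is a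
   supremum over the simple functions below [f]. *)
Lemma ge0_le_integral_nomeas d (T : measurableType d)
    (mu : {measure set T -> \bar R}) (f g : T -> \bar R) :
  (forall x, (0 <= f x)%E) -> (forall x, (f x <= g x)%E) ->
  (\int[mu]_x f x <= \int[mu]_x g x)%E.
Proof.
move=> f0 fg; have g0 x : (0 <= g x)%E := le_trans (f0 x) (fg x).
rewrite !ge0_integralE//= !patch_setT.
apply: le_ereal_sup => _ [h hf <-]; exists h => // x.
exact: le_trans (hf x) (fg x).
Qed.

Lemma integrable_bounded d (T : measurableType d) (P : probability T R)
    (f : T -> R) (M : R) :
  measurable_fun setT f -> (forall x, `|f x| <= M) ->
  P.-integrable setT (EFin \o f).
Proof.
move=> mf fM; apply: measurable_bounded_integrable => //.
  by rewrite (le_lt_trans (probability_le1 _ _))// ltry.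
exists M; split; first by rewrite num_real.
by move=> x Mx y _ /=; rewrite (le_trans (fM y))// ltW.
Qed.

Lemma fine_expectation d (T : measurableType d) (P : probability T R)
    (f : T -> R) : fine 'E_P[f] = \int[P]_x f x.
Proof. by rewrite unlock. Qed.

Lemma le_dist_Rintegral d (T : measurableType d) (P : probability T R)
    (f g : T -> R) (e : R) :
  P.-integrable setT (EFin \o f) -> P.-integrable setT (EFin \o g) ->
  (forall x, `|f x - g x| <= e) ->
  `|\int[P]_x f x - \int[P]_x g x| <= e.
Proof.
move=> fi gi fge.
have cst_i c : P.-integrable setT (EFin \o cst c).
  by apply: (@integrable_bounded _ _ _ _ `|c|).
have cstE c : \int[P]_x c = c.
  by rewrite Rintegral_cst//= probability_setT mulr1.
rewrite -RintegralB//.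
rewrite ler_norml -{1}(cstE (- e)) -{2}(cstE e).
have fgi : P.-integrable setT (EFin \o (f \- g)).
  exact: (integrableB measurableT fi gi).
apply/andP; split; apply: le_Rintegral => //; try exact: cst_i.
  by move=> x _; have := fge x; rewrite ler_norml => /andP[].
by move=> x _; have := fge x; rewrite ler_norml => /andP[].
Qed.

(** [u \o Y] is a finite combination of indicators of the fibres of [Y]. Only the fibres need be
    measurable, so [Q] carries no sigma-algebra. *)
Lemma integral_finite_range d (T : measurableType d) (P : probability T R)
    (Q : finType) (Y : T -> Q) (u : Q -> R) :
  (forall q, measurable (Y @^-1` [set q])) ->
  P.-integrable setT (EFin \o (u \o Y)) /\
  (\int[P]_x (u (Y x))%:E)%E =
  (\sum_q u q * fine (P (Y @^-1` [set q])))%:E.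
Proof.
move=> mY.
pose f q x : R := u q * \1_(Y @^-1` [set q]) x.
have uY x : (u (Y x))%:E = (\sum_q (f q x)%:E)%E.
  rewrite sumEFin (bigD1 (Y x))//= big1 ?addr0.
    by rewrite /f indicE mem_set// mulr1.
  move=> q qY; rewrite /f indicE memNset ?mulr0//= => Yq.
  by rewrite Yq eqxx in qY.
have fi q : P.-integrable setT (EFin \o f q).
  apply: (@integrable_bounded _ _ _ _ `|u q|).
    by apply: measurable_funM => //; exact: measurable_indic.
  move=> x; rewrite /f normrM ler_piMr// indicE.
  by case: (_ \in _); rewrite ?normr1 ?normr0.
have -> : EFin \o (u \o Y) = (fun x => \sum_q (EFin \o f q) x)%E.
  by apply/funext => x /=; rewrite uY.
split; first exact: integrable_sum.
under eq_integral do rewrite uY.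
rewrite integral_sum// -sumEFin; apply: eq_bigr => q _.
under eq_integral do rewrite /f EFinM.
rewrite integralZl//; last first.
  apply: (@integrable_bounded _ _ _ _ 1); first exact: measurable_indic.
  by move=> x; rewrite indicE; case: (_ \in _); rewrite ?normr1 ?normr0.
by rewrite integral_indic// setIT EFinM fineK// fin_num_measure.
Qed.

(* Each [phi j] is rounded to a grid of step [1 / T], at a total cost of [2]
   (once for the sum, once for the mean); the rounded tuple then has finite
   range, so that independence turns expectations into finite sums. *)
Lemma uniform_deviation (dO dS : measure_display) (Omega : measurableType dO)
    (S : measurableType dS) (P : probability Omega R) (D : probability S R)
    (T : nat) (Z : 'I_T -> {mfun Omega >-> S}) (J : finType)
    (phi : J -> S -> R) (b : R) :
  iid P D Z -> (0 < T)%N -> (0 < #|J|)%N ->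
  (forall j, measurable_fun setT (phi j)) -> (forall j s, `|phi j s| <= b) ->
  exists U : Omega -> R, [/\
    forall w j, `|\sum_t phi j (Z t w) - T%:R * \int[D]_s phi j s| <= U w,
    P.-integrable setT (EFin \o U) &
    (\int[P]_w (U w)%:E
      <= (2 + (1 + 8 * b ^+ 2) * Num.sqrt (T%:R * ln (2 * #|J|)%:R))%:E)%E].
Proof.
move=> [law indep] T0 J0 mphi phib.
have T0' : 0 < T%:R :> R by rewrite ltr0n.
(* The shifted and scaled value [(phi j s + b) * T] lies in [[0, 2 * b * T]], so [n] is the largest
   possible index. *)
pose n := Num.truncn (2 * b * T%:R).
pose idx (y : R) : 'I_n.+1 := inord (Num.truncn ((y + b) * T%:R)).
pose value (i : 'I_n.+1) : R := i%:R / T%:R - b.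
have y_ge0 j s : 0 <= (phi j s + b) * T%:R.
  rewrite mulr_ge0//; have := phib j s.
  by rewrite ler_norml -subr_ge0 opprK => /andP[].
have idxE j s : (idx (phi j s) : nat) = Num.truncn ((phi j s + b) * T%:R).
  rewrite inordK// ltnS le_truncn// ler_pM2r// mulr_natl mulr2n lerD2r.
  by rewrite (le_trans (ler_norm _)).
have idx_close j s : `|phi j s - value (idx (phi j s))| <= 1 / T%:R.
  have /andP[l u] := truncn_itv (y_ge0 j s).
  rewrite -idxE -natr1 in l u.
  rewrite ler_pdivlMr// -[X in _ * X](gtr0_norm T0') -normrM.
  have -> : (phi j s - value (idx (phi j s))) * T%:R =
      (phi j s + b) * T%:R - (idx (phi j s))%:R.
    by rewrite /value; field; rewrite gt_eqF.
  rewrite ler_norml; lra.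
have value_bd (j : J) i : `|value i| <= b.
  have b0 : 0 <= b := le_trans (normr_ge0 _) (phib j point).
  have i0 : 0 <= i%:R / T%:R :> R by rewrite divr_ge0.
  have iT : i%:R / T%:R <= 2 * b.
    rewrite ler_pdivrMr//; apply: (@le_trans _ _ n%:R).
      by rewrite ler_nat -ltnS.
    by rewrite truncn_le !mulr_ge0.
  by rewrite /value ler_norml; lra.
pose Q := {ffun J -> 'I_n.+1}.
pose Psi (s : S) : Q := [ffun j => idx (phi j s)].
have mPsi q : measurable (Psi @^-1` [set q]).
  (* Rounding down makes each fibre a finite intersection of preimages of half-open intervals. *)
  have -> : Psi @^-1` [set q] = \bigcap_(j in [set: J])
      phi j @^-1` `[(q j)%:R / T%:R - b, (q j).+1%:R / T%:R - b[%classic.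
    apply/seteqP; split => s /=.
      move=> <- j _ /=; rewrite ffunE in_itv/= idxE.
      rewrite lerBlDr ltrBrDr ler_pdivrMr// ltr_pdivlMr//.
      exact: truncn_itv.
    move=> sq; apply/ffunP => j; have := sq j I => /=; rewrite ffunE in_itv/=.
    rewrite lerBlDr ltrBrDr ler_pdivrMr// ltr_pdivlMr// => /truncn_def sqj.
    by apply/val_inj; rewrite /= -/(nat_of_ord _) idxE sqj.
  apply: fin_bigcap_measurable => // j _.
  by rewrite -[X in measurable X]setTI; apply: mphi.
pose p q := fine (D (Psi @^-1` [set q])).
have DE q : D (Psi @^-1` [set q]) = (p q)%:E by rewrite fineK// fin_num_measure.
have p0 q : 0 <= p q by rewrite fine_ge0.
have p1 : \sum_q p q = 1.
  have [_] := integral_finite_range D (fun=> 1) mPsi.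
  under [in X in _ = X -> _]eq_bigr do rewrite mul1r.
  by rewrite integral_cst//= probability_setT mule1 => -[].
pose mean j := \sum_(q : Q) value (q j) * p q.
have mean_close j : `|\int[D]_s phi j s - mean j| <= 1 / T%:R.
  have [vi vE] := integral_finite_range D (fun q : Q => value (q j)) mPsi.
  rewrite (_ : mean j = \int[D]_s value (Psi s j)); last first.
    by rewrite /Rintegral vE.
  apply: le_dist_Rintegral => //; first exact: integrable_bounded (phib j).
  by move=> s; rewrite ffunE.
(* Centering uses the mean of the rounded values, so that it is exact. It costs the bound [2 * b],
   whence [8 * b ^+ 2 = 2 * (2 * b) ^+ 2] in the conclusion. *)
pose v j (q : Q) := value (q j) - mean j.
have pv0 j : \sum_q p q * v j q = 0.
  under eq_bigr do rewrite mulrBr mulrC.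
  by rewrite sumrB -mulr_suml p1 mul1r subrr.
have v_bd j q : `|v j q| <= 2 * b.
  rewrite mulr_natl mulr2n (le_trans (ler_normB _ _))// lerD ?value_bd//.
  rewrite (le_trans (ler_norm_sum _ _ _))// -[leRHS]mulr1 -p1 mulr_sumr.
  apply: ler_sum => q' _.
  by rewrite normrM (ger0_norm (p0 _)) ler_wpM2r ?value_bd.
pose Y w : {ffun 'I_T -> Q} := [ffun t => Psi (Z t w)].
have YE s : Y @^-1` [set s] =
    \bigcap_(t in [set: 'I_T]) (Z t @^-1` (Psi @^-1` [set s t])).
  apply/seteqP; split => w /=; first by move=> <- t _ /=; rewrite ffunE.
  by move=> ws; apply/ffunP => t; rewrite ffunE; exact: ws.
have mY s : measurable (Y @^-1` [set s]).
  rewrite YE; apply: fin_bigcap_measurable => // t _.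
  by rewrite -[X in measurable X]setTI; apply: measurable_funPT.
(* Both halves of [iid] enter here: the rounded samples have the product law with weights [p]. *)
have PY s : fine (P (Y @^-1` [set s])) = \prod_t p (s t).
  have PZ t q : P (Z t @^-1` (Psi @^-1` [set q])) = (p q)%:E.
    by rewrite -DE; exact: law.
  rewrite YE indep//.
  rewrite (eq_bigr (fun t => (p (s t))%:E)) => [|t _]; last exact: PZ.
  by rewrite prodEFin.
have [Ui UE] := integral_finite_range P
  (fun s : {ffun 'I_T -> Q} => 2 + \big[Num.max/0]_j `|\sum_t v j (s t)|) mY.
exists (fun w => 2 + \big[Num.max/0]_j `|\sum_t v j (Y w t)|); split => //.
  move=> w j.
  (* Rounding error of the sum, rounding error of the mean, and fluctuation of the rounded sum; each
     of the first two is at most [T * (1 / T) = 1]. *)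
  have -> : \sum_t phi j (Z t w) - T%:R * \int[D]_s phi j s =
      \sum_t (phi j (Z t w) - value (idx (phi j (Z t w))))
      + (T%:R * (mean j - \int[D]_s phi j s) + \sum_t v j (Y w t)).
    have -> : \sum_t v j (Y w t) =
        \sum_t value (idx (phi j (Z t w))) - T%:R * mean j.
      rewrite /v sumrB sumr_const card_ord -[mean j *+ T]mulr_natl.
      by congr (_ - _); apply: eq_bigr => t _; rewrite !ffunE.
    rewrite (sumrB _ _ (fun t => phi j (Z t w))); ring.
  have -> : 2 = 1 + 1 :> R by [].
  rewrite -addrA (le_trans (ler_normD _ _))// lerD//.
    rewrite (le_trans (ler_norm_sum _ _ _))//.
    rewrite (le_trans (ler_sum _ (fun t _ => idx_close j (Z t w))))//.
    by rewrite sumr_const card_ord -[leLHS]mulr_natl mul1r divff ?gt_eqF.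
  rewrite (le_trans (ler_normD _ _))// lerD//; last exact: le_bigmax.
  by rewrite normrM gtr0_norm// distrC -ler_pdivlMl// mulrC.
rewrite UE lee_fin; under eq_bigr do rewrite PY mulrDl.
rewrite big_split/= -mulr_sumr sum_prod_ffun p1 expr1n mulr1 lerD2l.
under eq_bigr do rewrite mulrC.
have -> : 8 * b ^+ 2 = 2 * (2 * b) ^+ 2 by ring.
exact: mean_bigmax_le.
Qed.

(** * Losses *)

Lemma measurable_loss_eval (d : nat) (X : set 'rV[R]_d) (B G : {nonneg R})
    (x : 'rV[R]_d) : X x ->
  measurable_fun setT (fun f : loss X B G => f x).
Proof.
move=> Xx _ A mA; apply: sub_sigma_algebra.
by exists x => //; exists A.
Qed.

(** * Numerical estimates absorbing constants into the rate *)

Lemma expR_half_le2 : expR (2^-1) <= 2 :> R.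
Proof.
have := expR_ge1Dx (- 2^-1 : R); rewrite expRN => h.
have e0 := expR_gt0 (2^-1 : R).
have h1 : (2^-1 : R) <= (expR 2^-1)^-1 by lra.
by rewrite -lef_pV2 ?posrE.
Qed.

(** For [T >= 2] this makes [T * ln (T * K)] at least 1, so additive constants are absorbed by its
    square root. *)
Lemma half_le_ln2 : 2^-1 <= ln 2 :> R.
Proof. by rewrite -[leLHS]expRK ler_ln ?posrE ?expR_gt0// expR_half_le2. Qed.

(** A family of polynomial size costs only a constant factor: [ln N <= p * ln n], and [p <= p ^ 2]
    lets [p] leave the root. *)
Lemma sqrt_ln_natX_le (T n p : nat) (N : nat) : (0 < N)%N -> (0 < n)%N ->
  (0 < p)%N -> (N <= n ^ p)%N ->
  Num.sqrt (T%:R * ln N%:R) <= p%:R * Num.sqrt (T%:R * ln n%:R) :> R.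
Proof.
move=> N0 n0 p0 Nnp.
have ln0 : 0 <= ln n%:R :> R by rewrite ln_ge0// ler1n.
rewrite -[X in X * Num.sqrt _]ger0_norm// -sqrtr_sqr -sqrtrM ?sqr_ge0//.
rewrite ler_wsqrtr// mulrCA ler_wpM2l//.
apply: (@le_trans _ _ (p%:R * ln n%:R)).
  rewrite mulr_natl -lnXn ?ltr0n// -natrX ler_ln ?posrE ?ltr0n ?expn_gt0 ?n0//.
  by rewrite ler_nat.
by rewrite ler_wpM2r// -natrX ler_nat expnS expn1 leq_pmulr.
Qed.

(** Common form of the two claims: [F] reads the [K] losses off a sample of any type, and [a] is the
    pathwise maximum of their sums. [C] is chosen before [T], [K] and the distribution. *)
Lemma loss_minmax_concentration (d : nat) (X : set 'rV[R]_d)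
    (B G : {nonneg R}) : X !=set0 -> finite_ediam X ->
  exists2 C : R, 0 < C &
    forall (T K : nat), (2 <= T)%N -> (1 <= K)%N ->
    forall (dO dS : measure_display) (Omega : measurableType dO)
      (S : measurableType dS) (P : probability Omega R) (D : probability S R)
      (Z : 'I_T -> {mfun Omega >-> S}) (F : S -> 'I_K -> loss X B G)
      (a : Omega -> 'rV[R]_d -> R) (mu : 'rV[R]_d -> 'rV[R]_K),
    iid P D Z ->
    (forall x k, X x -> measurable_fun setT (fun s => F s k x)) ->
    (forall w x k, X x -> \sum_(t < T) F (Z t w) k x <= a w x) ->
    (forall w x y, X x -> (forall k, \sum_(t < T) F (Z t w) k x <= y) ->
       a w x <= y) ->
    (forall x k, X x -> mu x ord0 k = fine 'E_D[fun s => F s k x]) ->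
    ('E_P[fun w => (`|inf [set a w x | x in X] - minmax_mean X T mu|)%R]
      <= (C * Num.sqrt (T%:R * ln (T * K)%:R))%:E)%E.
Proof.
move=> X0 Xdiam; have [m net] := grid_net X0 Xdiam.
pose g : R := G%:num * d%:R; pose b : R := B%:num.
(* Chosen so that [2 * (m * T + 1) ^ d * K <= (T * K) ^ p]: [m * T + 1 <= (T * K) ^ m.+1] is raised
   to the power [d], and one more factor [T * K] covers [2 * K]. *)
pose p := (m.+1 * d).+1.
have g0 : 0 <= g by rewrite mulr_ge0.
exists ((2 + 2 * g) + (1 + 8 * b ^+ 2) * p%:R).
  have : 0 <= (1 + 8 * b ^+ 2) * p%:R :> R.
    by rewrite mulr_ge0// addr_ge0// mulr_ge0// sqr_ge0.
  lra.
move=> T K T2 K1 dO dS Omega S P D Z F a mu iidZ mF a_ub a_lub muE.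
have T0 : (0 < T)%N by apply: leq_trans T2.
have T0' : 0 < T%:R :> R by rewrite ltr0n.
have [r [Xr r_close]] := net T T0.
pose J := ({ffun 'I_d -> 'I_(m * T).+1} * 'I_K)%type.
have cardJ : #|{: J}| = ((m * T).+1 ^ d * K)%N.
  by rewrite card_prod card_ffun !card_ord.
have J0 : (0 < #|{: J}|)%N by rewrite cardJ muln_gt0 expn_gt0.
have Fb s k x : X x -> `|F s k x| <= b.
  by move=> Xx; have [_ + _] := lossP (F s k); apply.
have FL s k x y : X x -> X y -> `|F s k x - F s k y| <= G%:num * enorm (x - y).
  by move=> Xx Xy; have [_ _] := lossP (F s k); apply.
have Fi x k : X x -> D.-integrable setT (EFin \o (fun s => F s k x)).
  move=> Xx; apply: (@integrable_bounded _ _ _ _ b); first exact: mF.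
  by move=> s; exact: Fb.
have [||U [U_dev Ui U_mean]] := @uniform_deviation dO dS Omega S P D T Z J
  (fun j s => F s j.2 (r j.1)) b iidZ T0 J0.
- by move=> j; exact: mF.
- by move=> j s; exact: Fb.
(* Moving [x] to a net point at distance at most [d / T] changes the sum and [T * mu] by at most
   [g = G * d] each. *)
have close w x k : X x ->
    `|\sum_t F (Z t w) k x - T%:R * mu x ord0 k| <= U w + 2 * g.
  move=> Xx; have [i xi] := r_close x Xx.
  have Gxi : G%:num * enorm (x - r i) <= g / T%:R.
    by rewrite /g -mulrA ler_wpM2l.
  have dev := U_dev w (i, k); rewrite /= in dev.
  have mu_close : `|mu x ord0 k - \int[D]_s F s k (r i)| <= g / T%:R.
    rewrite muE// fine_expectation le_dist_Rintegral//; [exact: Fi|exact: Fi|].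
    by move=> s; exact: le_trans (FL s k x (r i) Xx (Xr i)) Gxi.
  have sum_close : `|\sum_t F (Z t w) k x - \sum_t F (Z t w) k (r i)| <= g.
    rewrite -sumrB (le_trans (ler_norm_sum _ _ _))//.
    apply: (@le_trans _ _ (\sum_(t < T) g / T%:R)).
      by apply: ler_sum => t _; exact: le_trans (FL _ k x (r i) Xx (Xr i)) Gxi.
    by rewrite sumr_const card_ord -[leLHS]mulr_natr divfK ?gt_eqF.
  have Tmu_close : `|T%:R * mu x ord0 k - T%:R * \int[D]_s F s k (r i)| <= g.
    by rewrite -mulrBr normrM gtr0_norm// mulrC -ler_pdivlMr.
  move: dev sum_close Tmu_close; rewrite !ler_norml.
  move=> /andP[? ?] /andP[? ?] /andP[? ?]; lra.
have mu_bd x k : X x -> `|mu x ord0 k| <= b.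
  move=> Xx; rewrite muE// fine_expectation -[X in `|X|]subr0.
  have -> : 0 = \int[D]_s 0 :> R by rewrite Rintegral_cst// mul0r.
  apply: le_dist_Rintegral; [exact: Fi| |].
    by apply: (@integrable_bounded _ _ _ _ 0) => // s; rewrite normr0.
  by move=> s; rewrite subr0 Fb.
have pathwise w :
    `|inf [set a w x | x in X] - minmax_mean X T mu| <= U w + 2 * g.
  apply: (@inf_minmax_close d K T X (a w)
    (fun x k => \sum_t F (Z t w) k x) mu b) => //.
  - by move=> x k; exact: a_ub.
  - by move=> x y; exact: a_lub.
  - by move=> x k; exact: close.
rewrite unlock.
(* Domination by the integrable [U] avoids proving that the infimum over [X] is measurable in
   [w]. *)
apply: (@le_trans _ _ (\int[P]_w (U w + 2 * g)%:E)%E).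
  apply: ge0_le_integral_nomeas => w; first by rewrite lee_fin.
  by rewrite lee_fin pathwise.
have gi : P.-integrable setT (EFin \o cst (2 * g)).
  exact: (@integrable_bounded _ _ _ _ `|2 * g|).
have gE : (\int[P]_w (2 * g)%:E = (2 * g)%:E)%E.
  by rewrite integral_cst//= probability_setT mule1.
under eq_integral do rewrite EFinD.
have -> : (\int[P]_w ((U w)%:E + (2 * g)%:E)
           = \int[P]_w (U w)%:E + (2 * g)%:E)%E.
  by rewrite -[in RHS]gE; exact: (integralD measurableT Ui gi).
apply: (le_trans (leeD2r _ U_mean)); rewrite -EFinD lee_fin.
have le_ln : ln 2 <= ln (T * K)%:R :> R.
  rewrite ler_ln ?posrE ?ltr0n ?muln_gt0 ?T0//.
  by rewrite ler_nat (leq_trans T2)// leq_pmulr.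
set L := Num.sqrt (T%:R * ln (T * K)%:R).
have L1 : 1 <= L.
  rewrite -[leLHS]sqrtr1 ler_wsqrtr//.
  apply: (@le_trans _ _ (2 * 2^-1)); first by rewrite divff.
  by apply: ler_pM => //; [rewrite ler_nat|exact: le_trans half_le_ln2 le_ln].
have card_le : (2 * #|{: J}| <= (T * K) ^ p)%N.
  have leq_exp2 u v e : (u <= v)%N -> (u ^ e <= v ^ e)%N.
    by case: e => // e; rewrite leq_exp2r.
  rewrite cardJ mulnCA /p expnSr expnM leq_mul//; last by rewrite leq_mul.
  apply: (leq_exp2); apply: (@leq_trans (m.+1 * T)).
    by rewrite mulSn -add1n leq_add2r.
  rewrite expnSr leq_mul ?leq_pmulr//.
  rewrite (leq_trans (ltn_expl m (ltnSn 1)))// leq_exp2//.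
  by rewrite (leq_trans T2)// leq_pmulr.
have := sqrt_ln_natX_le T (N := (2 * #|{: J}|)%N) (n := (T * K)%N) (p := p).
rewrite !muln_gt0 J0 T0 K1 /= => /(_ isT isT isT card_le); rewrite -/L => h.
have h2 : (1 + 8 * b ^+ 2) * Num.sqrt (T%:R * ln (2 * #|{: J}|)%:R)
    <= (1 + 8 * b ^+ 2) * p%:R * L.
  by rewrite -mulrA ler_wpM2l// addr_ge0// mulr_ge0// sqr_ge0.
have h3 : 2 + 2 * g <= (2 + 2 * g) * L.
  by rewrite ler_peMr// addr_ge0// mulr_ge0.
by rewrite [leRHS]mulrDl [leLHS]addrAC lerD.
Qed.

End Concentration.

(** * Specialization to pairs and to [K]-tuples of losses *)

Theorem mainTheorem4 (R : realType) (d : nat) (X : set 'rV[R]_d)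
    (B G : {nonneg R})
    (X_nonempty : X !=set0) (X_closed : closed X) (X_convex : convex_set X)
    (X_diam : finite_ediam X) :
  (exists2 C : R, 0 < C &
    forall (T : nat), (2 <= T)%N ->
    forall (dO : measure_display) (Omega : measurableType dO)
      (P : probability Omega R)
      (D : probability (loss X B G * loss X B G)%type R)
      (Z : 'I_T -> {mfun Omega >-> (loss X B G * loss X B G)%type}),
    iid P D Z ->
    ('E_P[fun w => (`|C_OPT2 (fun t => Z t w) - Cbar_OPT2 T D|)%R]
      <= (C * Num.sqrt (T%:R * ln T%:R))%:E)%E)
  /\
  (exists2 C : R, 0 < C &
    forall (T K : nat), (2 <= T)%N -> (1 <= K)%N ->
    forall (dO : measure_display) (Omega : measurableType dO)
      (P : probability Omega R)
      (D : probability (K.-tuple (loss X B G)) R)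
      (Z : 'I_T -> {mfun Omega >-> K.-tuple (loss X B G)}),
    iid P D Z ->
    ('E_P[fun w => (`|C_OPT (fun t => Z t w) - Cbar_OPT T D|)%R]
      <= (C * Num.sqrt (T%:R * ln (T * K)%:R))%:E)%E).
Proof.
have [C C0 bound] := loss_minmax_concentration B G X_nonempty X_diam.
split.
  (* The case [K = 2] gives [ln (T * 2)]; as [T * 2 <= T ^ 2], replacing it by [ln T] costs at most
     a factor 2. *)
  exists (C * 2); first by rewrite mulr_gt0.
  move=> T T2 dO Omega P D Z iidZ.
  pose F (s : loss X B G * loss X B G) (k : 'I_2) :=
    if k == ord0 then s.1 else s.2.
  apply: le_trans (bound T 2%N T2 isT dO _ Omega _ P D Z F
    (fun w x => Num.max (\sum_(t < T) (Z t w).1 x) (\sum_(t < T) (Z t w).2 x))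
    (mean2 D) iidZ _ _ _ _) _.
  - move=> x k Xx; rewrite /F; case: (k == ord0).
      exact: measurableT_comp (measurable_loss_eval Xx) measurable_fst.
    exact: measurableT_comp (measurable_loss_eval Xx) measurable_snd.
  - move=> w x k Xx; rewrite /F le_max.
    by case: (k == ord0); rewrite lexx ?orbT.
  - move=> w x y Xx le_y; rewrite ge_max.
    by have := le_y ord0; have := le_y ord_max; rewrite /F /= => -> ->.
  - by move=> x k Xx; rewrite mxE /F; case: (k == ord0).
  - rewrite lee_fin -mulrA ler_pM2l//.
    have T0 : (0 < T)%N by apply: leq_trans T2.
    apply: sqrt_ln_natX_le => //; first by rewrite muln_gt0 T0.
    by rewrite expnS expn1 leq_mul.
exists C => // T K T2 K1 dO Omega P D Z iidZ.
apply: (bound T K T2 K1 dO _ Omega _ P D Z (fun s k => tnth s k)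
  (fun w x => sup [set \sum_(t < T) tnth (Z t w) k x | k in [set: 'I_K]])
  (meanK D) iidZ).
- move=> x k Xx.
  exact: measurableT_comp (measurable_loss_eval Xx) (measurable_tnth k).
- move=> w x k Xx; apply: ub_le_sup; last by exists k.
  exists (\sum_j `|\sum_(t < T) tnth (Z t w) j x|) => _ [j _ <-].
  rewrite (le_trans (ler_norm _))// (bigD1 j)//= lerDl.
  by apply: sumr_ge0.
(* [K >= 1] makes the set of sums nonempty, as bounding its [sup] from above requires. *)
- move=> w x y Xx le_y; apply: ge_sup; last by move=> _ [k _ <-].
  by pose k0 : 'I_K := Ordinal K1; exists (\sum_(t < T) tnth (Z t w) k0 x), k0.
- by move=> x k Xx; rewrite mxE.
Qed.
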